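(* Let $\mathbb{X}$ be a category with finite biproducts and let $(!, \delta, \varepsilon)$ be a comonad on $\mathbb{X}$. Suppose that the coKleisli category $\mathbb{X}_!$ is a Cartesian differential category with differential combinator $\mathsf{D}$ such that: (i) the underlying Cartesian left additive structure of $\mathbb{X}_!$ is the canonical one; (ii) for every map $f : A \to B$ in $\mathbb{X}$, $[\![ \mathsf{F}_!(f) ]\!]$ is a $\mathsf{D}$-linear map in $\mathbb{X}_!$. Define $\partial_A : !(A \times A) \to !(A)$ by $\partial_A := [\![ \mathsf{D}[\varphi_A] ]\!]$. Then $\partial$ is a natural transformation, $(!, \delta, \varepsilon, \partial)$ is a Cartesian differential comonad, and furthermore for every coKleisli map $[\![ f ]\!] : !(A) \to B$ the following equality holds in $\mathbb{X}$: $$[\![ \mathsf{D}[f] ]\!] = [\![ f ]\!] \circ \partial_A .$$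
   Context: Composition is in classical order: $g \circ f$ means first $f$, then $g$. In a category with (chosen) finite products, $\pi_0,\pi_1$ are the projections of $A\times B$, $\langle f,g\rangle$ is pairing, $h\times k=\langle h\circ\pi_0,k\circ\pi_1\rangle$, and $\top$ is the terminal object. Cartesian left additive categories. A left additive category is a category whose hom-sets are commutative monoids (with $+$ and $0$) such that $(f+g)\circ x=f\circ x+g\circ x$ and $0\circ x=0$. A map $f$ is additive if $f\circ(x+y)=f\circ x+f\circ y$ and $f\circ 0=0$. A Cartesian left additive category is a left additive category with finite products in which all projections are additive. A category with finite biproducts is regarded as a Cartesian left additive category (in which every map is additive). In a Cartesian left additive category define $\iota_0=\langle 1_A,0\rangle: A\to A\times B$, $\iota_1=\langle 0,1_B\rangle: B\to A\times B$, $\nabla_A=\pi_0+\pi_1: A\times A\to A$, $\ell_A=\iota_0\times\iota_1: A\times A\to (A\times A)\times(A\times A)$, $c_A=\langle\pi_0\times\pi_0,\pi_1\times\pi_1\rangle:(A\times A)\times(A\times A)\to(A\times A)\times(A\times A)$. Cartesian differential categories. A differential combinator on a Cartesian left additive category is a family of operators sending $f:A\to B$ to $\mathsf{D}[f]:A\times A\to B$ with: [CD.1] $\mathsf{D}[f+g]=\mathsf{D}[f]+\mathsf{D}[g]$, $\mathsf{D}[0]=0$; [CD.2] $\mathsf{D}[f]\circ(1_A\times\nabla_A)=\mathsf{D}[f]\circ(1_A\times\pi_0)+\mathsf{D}[f]\circ(1_A\times\pi_1)$, $\mathsf{D}[f]\circ\iota_0=0$; [CD.3] $\mathsf{D}[1_A]=\pi_1$,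 $\mathsf{D}[\pi_0]=\pi_0\circ\pi_1$, $\mathsf{D}[\pi_1]=\pi_1\circ\pi_1$; [CD.4] $\mathsf{D}[\langle f,g\rangle]=\langle\mathsf{D}[f],\mathsf{D}[g]\rangle$; [CD.5] $\mathsf{D}[g\circ f]=\mathsf{D}[g]\circ\langle f\circ\pi_0,\mathsf{D}[f]\rangle$; [CD.6] $\mathsf{D}[\mathsf{D}[f]]\circ\ell_A=\mathsf{D}[f]$; [CD.7] $\mathsf{D}[\mathsf{D}[f]]\circ c_A=\mathsf{D}[\mathsf{D}[f]]$. A Cartesian differential category is a Cartesian left additive category with a differential combinator. A map $f$ is $\mathsf{D}$-linear if $\mathsf{D}[f]=f\circ\pi_1$. coKleisli categories. For a comonad $(!,\delta,\varepsilon)$ on $\mathbb{X}$ ($\delta_A:!(A)\to !!(A)$, $\varepsilon_A:!(A)\to A$), the coKleisli category $\mathbb{X}_!$ has the objects of $\mathbb{X}$, and a map $f:A\to B$ in $\mathbb{X}_!$ is a map $[\![f]\!]:!(A)\to B$ in $\mathbb{X}$; $[\![g\circ f]\!]=[\![g]\!]\circ !([\![f]\!])\circ\delta_A$ and $[\![1_A]\!]=\varepsilon_A$. Equations between bracketed maps use composition in $\mathbb{X}$ outside brackets and composition in $\mathbb{X}_!$ inside brackets. The functor $\mathsf{F}_!:\mathbb{X}\to\mathbb{X}_!$ is the identity on objects with $[\![\mathsf{F}_!(f)]\!]=f\circ\varepsilon_A$. The coKleisli map $\varphi_A: A\to !(A)$ is given by $[\![\varphi_A]\!]=1_{!(A)}$.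 If $\mathbb{X}$ is Cartesian left additive, the canonical Cartesian left additive structure of $\mathbb{X}_!$ is: products on objects and $\top$ as in $\mathbb{X}$, $[\![\pi_j]\!]=\pi_j\circ\varepsilon_{A\times B}$, $[\![\langle f,g\rangle]\!]=\langle[\![f]\!],[\![g]\!]\rangle$, $[\![f+g]\!]=[\![f]\!]+[\![g]\!]$, $[\![0]\!]=0$. Cartesian differential comonads. Let $(!,\delta,\varepsilon)$ be a comonad on a category $\mathbb{X}$ with finite biproducts. A differential combinator transformation is a natural transformation $\partial_A:!(A\times A)\to !(A)$ with: [dc.1] $\partial_A\circ !(\iota_0)=0$; [dc.2] $\partial_A\circ !(1_A\times\nabla_A)=\partial_A\circ(!(1_A\times\pi_0)+!(1_A\times\pi_1))$; [dc.3] $\varepsilon_A\circ\partial_A=\pi_1\circ\varepsilon_{A\times A}$; [dc.4] $\delta_A\circ\partial_A=\partial_{!(A)}\circ !(\langle !(\pi_0),\partial_A\rangle)\circ\delta_{A\times A}$; [dc.5] $\partial_A\circ\partial_{A\times A}\circ !(\ell_A)=\partial_A$; [dc.6] $\partial_A\circ\partial_{A\times A}\circ !(c_A)=\partial_A\circ\partial_{A\times A}$. A Cartesian differential comonad is a quadruple $(!,\delta,\varepsilon,\partial)$ consisting of such a comonad and a differential combinator transformation. *)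

(* Defs.v *)
(* Self-contained development of the categorical notions, with Leibniz equality
   of morphisms; nothing beyond the Rocq prelude is needed.

   Composition is in classical order: [g ∘ f] is "first f, then g". *)

Set Implicit Arguments.
Unset Strict Implicit.
Unset Printing Implicit Defensive.

Declare Scope cat_scope.
Delimit Scope cat_scope with cat.
Local Open Scope cat_scope.

Record Category := {
  Obj :> Type;
  Hom : Obj -> Obj -> Type;
  idm : forall A, Hom A A;
  comp : forall A B C, Hom B C -> Hom A B -> Hom A C;
  comp_id_l : forall A B (f : Hom A B), comp (idm B) f = f;
  comp_id_r : forall A B (f : Hom A B), comp f (idm A) = f;
  comp_assoc : forall A B C E (h : Hom C E) (g : Hom B C) (f : Hom A B),
    comp h (comp g f) = comp (comp h g) f
}.

Arguments Hom {c} A B.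
Arguments idm {c} A.
Arguments comp {c A B C} g f.

Notation "g ∘ f" := (comp g f) (at level 40, left associativity) : cat_scope.

Record Functor (C E : Category) := {
  fobj :> C -> E;
  fmap : forall A B, Hom A B -> Hom (fobj A) (fobj B);
  fmap_id : forall A, fmap (idm A) = idm (fobj A);
  fmap_comp : forall (A B B' : C) (g : Hom B B') (f : Hom A B),
    fmap (g ∘ f) = fmap g ∘ fmap f
}.

Arguments fmap {C E} f0 {A B} f.

Definition id_functor (C : Category) : Functor C C :=
  {| fobj := fun A => A;
     fmap := fun A B f => f;
     fmap_id := fun A => eq_refl;
     fmap_comp := fun A B B' g f => eq_refl |}.

Definition comp_functor (C E K : Category) (G : Functor E K) (F : Functor C E) :
  Functor C K.
Proof.
  refine {| fobj := fun A => G (F A);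
            fmap := fun A B f => fmap G (fmap F f) |}.
  - intros A. rewrite fmap_id. apply fmap_id.
  - intros A B B' g f. rewrite fmap_comp. apply fmap_comp.
Defined.

Definition is_natural (C E : Category) (F G : Functor C E)
    (t : forall A, Hom (F A) (G A)) : Prop :=
  forall (A B : C) (f : Hom A B), t B ∘ fmap F f = fmap G f ∘ t A.

Arguments is_natural {C E} F G t.

Record Comonad (X : Category) := {
  bang :> Functor X X;
  dup : forall A, Hom (bang A) (bang (bang A));
  counit : forall A, Hom (bang A) A;
  dup_natural : is_natural bang (comp_functor bang bang) dup;
  counit_natural : is_natural bang (id_functor X) counit;
  counit_dup : forall A, counit (bang A) ∘ dup A = idm (bang A);
  fmap_counit_dup : forall A, fmap bang (counit A) ∘ dup A = idm (bang A);
  dup_dup : forall A, dup (bang A) ∘ dup A = fmap bang (dup A) ∘ dup A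
}.

Lemma counit_fmap (X : Category) (M : Comonad X) (A B : X) (f : Hom A B) :
  counit M B ∘ fmap M f = f ∘ counit M A.
Proof. exact (counit_natural M f). Qed.

Lemma dup_fmap (X : Category) (M : Comonad X) (A B : X) (f : Hom A B) :
  dup M B ∘ fmap M f = fmap M (fmap M f) ∘ dup M A.
Proof. exact (dup_natural M f). Qed.

Definition coKleisli (X : Category) (M : Comonad X) : Category.
Proof.
  refine {| Obj := Obj X;
            Hom := fun A B => @Hom X (M A) B;
            idm := fun A => counit M A;
            comp := fun A B C g f => g ∘ fmap M f ∘ dup M A |}.
  - intros A B f.
    rewrite counit_fmap, <- comp_assoc, counit_dup. apply comp_id_r.
  - intros A B f.
    rewrite <- comp_assoc, fmap_counit_dup. apply comp_id_r.
  - intros A B C E h g f.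
    rewrite !fmap_comp, <- !comp_assoc. do 2 f_equal.
    rewrite <- dup_dup.
    rewrite !comp_assoc. f_equal.
    symmetry. apply dup_fmap.
Defined.

(* The map of [X] underlying a coKleisli map.  It is the identity function: it
   only records in which of the two categories a composite is taken. *)
Definition bracket (X : Category) (M : Comonad X) (A B : X)
    (f : @Hom (coKleisli M) A B) : @Hom X (M A) B := f.

Arguments bracket {X M A B} f.

Notation "⟦ f ⟧" := (bracket f) (at level 0, format "⟦ f ⟧") : cat_scope.

Definition coKleisli_F (X : Category) (M : Comonad X) :
  Functor X (coKleisli M).
Proof.
  refine {| fobj := fun A : X => (A : coKleisli M);
            fmap := fun A B (f : @Hom X A B) => f ∘ counit M A |}.
  - intros A. exact (comp_id_l (counit M A)).
  - intros A B B' g f. simpl.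
    rewrite fmap_comp, <- !comp_assoc. f_equal.
    rewrite (comp_assoc (counit M B)), counit_fmap.
    now rewrite <- comp_assoc, fmap_counit_dup, comp_id_r.
Defined.

Definition phi (X : Category) (M : Comonad X) (A : X) :
  @Hom (coKleisli M) A (M A) := @idm X (M A).

(* Only precomposition is required to preserve [+] and [0]. *)
Class CartesianLeftAdditive (C : Category) := {
  addm : forall A B : C, Hom A B -> Hom A B -> Hom A B;
  zerom : forall A B : C, Hom A B;
  addm_assoc : forall (A B : C) (f g h : Hom A B),
    addm f (addm g h) = addm (addm f g) h;
  addm_comm : forall (A B : C) (f g : Hom A B), addm f g = addm g f;
  addm_0_l : forall (A B : C) (f : Hom A B), addm (zerom A B) f = f;
  addm_comp : forall (A B B' : C) (f g : Hom B B') (x : Hom A B),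
    addm f g ∘ x = addm (f ∘ x) (g ∘ x);
  zerom_comp : forall (A B B' : C) (x : Hom A B), zerom B B' ∘ x = zerom A B';
  top : C;
  to_top : forall A : C, Hom A top;
  to_top_unique : forall (A : C) (f : Hom A top), f = to_top A;
  prod : C -> C -> C;
  proj0 : forall A B : C, Hom (prod A B) A;
  proj1 : forall A B : C, Hom (prod A B) B;
  pair : forall (Z A B : C), Hom Z A -> Hom Z B -> Hom Z (prod A B);
  proj0_pair : forall (Z A B : C) (f : Hom Z A) (g : Hom Z B),
    proj0 A B ∘ pair f g = f;
  proj1_pair : forall (Z A B : C) (f : Hom Z A) (g : Hom Z B),
    proj1 A B ∘ pair f g = g;
  pair_unique : forall (Z A B : C) (f : Hom Z A) (g : Hom Z B)
      (h : Hom Z (prod A B)),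
    proj0 A B ∘ h = f -> proj1 A B ∘ h = g -> h = pair f g;
  proj0_add : forall (Z A B : C) (x y : Hom Z (prod A B)),
    proj0 A B ∘ addm x y = addm (proj0 A B ∘ x) (proj0 A B ∘ y);
  proj0_0 : forall Z A B : C, proj0 A B ∘ zerom Z (prod A B) = zerom Z A;
  proj1_add : forall (Z A B : C) (x y : Hom Z (prod A B)),
    proj1 A B ∘ addm x y = addm (proj1 A B ∘ x) (proj1 A B ∘ y);
  proj1_0 : forall Z A B : C, proj1 A B ∘ zerom Z (prod A B) = zerom Z B
}.

Arguments addm {C _ A B} f g.
Arguments zerom {C _ A B}.
Arguments top {C _}.
Arguments to_top {C _} A.
Arguments prod {C _} A B.
Arguments proj0 {C _ A B}.
Arguments proj1 {C _ A B}.
Arguments pair {C _ Z A B} f g.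

Notation "f + g" := (addm f g) : cat_scope.
Notation "0" := zerom : cat_scope.
Notation "A × B" := (prod A B) (at level 40, left associativity) : cat_scope.
Notation "⟨ f , g ⟩" := (pair f g) (at level 0, format "⟨ f ,  g ⟩") : cat_scope.
Notation "'π0'" := proj0 : cat_scope.
Notation "'π1'" := proj1 : cat_scope.

Section CLADerived.
Context {C : Category} {CLA : CartesianLeftAdditive C}.

Definition additive (A B : C) (f : Hom A B) : Prop :=
  (forall (Z : C) (x y : Hom Z A), f ∘ (x + y) = f ∘ x + f ∘ y) /\
  (forall Z : C, f ∘ (0 : Hom Z A) = 0).

Definition prodm (A A' B B' : C) (h : Hom A A') (k : Hom B B') :
  Hom (A × B) (A' × B') := ⟨h ∘ π0, k ∘ π1⟩.

Definition inj0 (A B : C) : Hom A (A × B) := ⟨idm A, 0⟩.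
Definition inj1 (A B : C) : Hom B (A × B) := ⟨0, idm B⟩.
Definition nabla (A : C) : Hom (A × A) A := π0 + π1.

Definition lift (A : C) : Hom (A × A) ((A × A) × (A × A)) :=
  prodm (inj0 A A) (inj1 A A).

Definition flip (A : C) : Hom ((A × A) × (A × A)) ((A × A) × (A × A)) :=
  ⟨prodm π0 π0, prodm π1 π1⟩.

Lemma pair_ext (Z A B : C) (h k : Hom Z (A × B)) :
  π0 ∘ h = π0 ∘ k -> π1 ∘ h = π1 ∘ k -> h = k.
Proof.
  intros H0 H1.
  rewrite (pair_unique H0 H1). symmetry. now apply pair_unique.
Qed.

Definition square_functor : Functor C C.
Proof.
  refine {| fobj := fun A => A × A; fmap := fun A B f => prodm f f |}.
  - intros A. symmetry. apply pair_unique;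
      now rewrite comp_id_l, comp_id_r.
  - intros A B B' g f. symmetry. unfold prodm. apply pair_unique.
    + now rewrite comp_assoc, proj0_pair, <- comp_assoc, proj0_pair, comp_assoc.
    + now rewrite comp_assoc, proj1_pair, <- comp_assoc, proj1_pair, comp_assoc.
Defined.

End CLADerived.

Arguments prodm {C CLA A A' B B'} h k.
Arguments inj0 {C CLA A B}.
Arguments inj1 {C CLA A B}.
Arguments nabla {C CLA} A.
Arguments lift {C CLA} A.
Arguments flip {C CLA} A.
Arguments square_functor C {CLA}.

Notation "h ×m k" := (prodm h k) (at level 40, left associativity) : cat_scope.

#[export] Instance coKleisli_CLA (X : Category) (CLA : CartesianLeftAdditive X)
  (M : Comonad X) : CartesianLeftAdditive (coKleisli M).
Proof.
  assert (aux : forall (Z A B : X) (p : Hom A B) (x : Hom (M Z) A),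
    p ∘ counit M A ∘ fmap M x ∘ dup M Z = p ∘ x).
  { intros Z A B p x.
    rewrite <- (comp_assoc p), counit_fmap.
    now rewrite <- !comp_assoc, counit_dup, comp_id_r. }
  refine {|
    addm := fun (A B : coKleisli M) (f g : @Hom (coKleisli M) A B) =>
              @addm X _ (M A) B f g;
    zerom := fun A B : coKleisli M => @zerom X _ (M A) B;
    top := @top X _ : coKleisli M;
    to_top := fun A : coKleisli M => @to_top X _ (M A);
    prod := fun A B : coKleisli M => @prod X _ A B;
    proj0 := fun A B : coKleisli M => @proj0 X _ A B ∘ counit M _;
    proj1 := fun A B : coKleisli M => @proj1 X _ A B ∘ counit M _;
    pair := fun (Z A B : coKleisli M) (f : @Hom (coKleisli M) Z A)
                (g : @Hom (coKleisli M) Z B) => @pair X _ (M Z) A B f g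
  |}; simpl; intros.
  - apply addm_assoc.
  - apply addm_comm.
  - apply addm_0_l.
  - now rewrite !addm_comp.
  - now rewrite !zerom_comp.
  - apply to_top_unique.
  - rewrite aux. apply proj0_pair.
  - rewrite aux. apply proj1_pair.
  - rewrite aux in *. now apply pair_unique.
  - rewrite !aux. apply proj0_add.
  - rewrite aux. apply proj0_0.
  - rewrite !aux. apply proj1_add.
  - rewrite aux. apply proj1_0.
Defined.

(* A zero object, and binary biproducts: objects that are a product and a
   coproduct in a compatible way.  No addition of maps is assumed: it is derived
   below, and makes every map additive. *)
Class FiniteBiproducts (C : Category) := {
  zobj : C;
  to_zobj : forall A : C, Hom A zobj;
  from_zobj : forall A : C, Hom zobj A;
  to_zobj_unique : forall (A : C) (f : Hom A zobj), f = to_zobj A;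
  from_zobj_unique : forall (A : C) (f : Hom zobj A), f = from_zobj A;
  bip : C -> C -> C;
  bproj0 : forall A B : C, Hom (bip A B) A;
  bproj1 : forall A B : C, Hom (bip A B) B;
  binj0 : forall A B : C, Hom A (bip A B);
  binj1 : forall A B : C, Hom B (bip A B);
  bpair : forall Z A B : C, Hom Z A -> Hom Z B -> Hom Z (bip A B);
  bproj0_pair : forall (Z A B : C) (f : Hom Z A) (g : Hom Z B),
    bproj0 A B ∘ bpair f g = f;
  bproj1_pair : forall (Z A B : C) (f : Hom Z A) (g : Hom Z B),
    bproj1 A B ∘ bpair f g = g;
  bpair_unique : forall (Z A B : C) (f : Hom Z A) (g : Hom Z B)
      (h : Hom Z (bip A B)),
    bproj0 A B ∘ h = f -> bproj1 A B ∘ h = g -> h = bpair f g;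
  bcopair : forall Z A B : C, Hom A Z -> Hom B Z -> Hom (bip A B) Z;
  bcopair_inj0 : forall (Z A B : C) (f : Hom A Z) (g : Hom B Z),
    bcopair f g ∘ binj0 A B = f;
  bcopair_inj1 : forall (Z A B : C) (f : Hom A Z) (g : Hom B Z),
    bcopair f g ∘ binj1 A B = g;
  bcopair_unique : forall (Z A B : C) (f : Hom A Z) (g : Hom B Z)
      (h : Hom (bip A B) Z),
    h ∘ binj0 A B = f -> h ∘ binj1 A B = g -> h = bcopair f g;
  bproj0_inj0 : forall A B : C, bproj0 A B ∘ binj0 A B = idm A;
  bproj1_inj1 : forall A B : C, bproj1 A B ∘ binj1 A B = idm B;
  bproj1_inj0 : forall A B : C,
    bproj1 A B ∘ binj0 A B = from_zobj B ∘ to_zobj A;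
  bproj0_inj1 : forall A B : C,
    bproj0 A B ∘ binj1 A B = from_zobj A ∘ to_zobj B
}.

Section BiproductAddition.
Context {C : Category} {BP : FiniteBiproducts C}.

Definition bzero (A B : C) : Hom A B := from_zobj B ∘ to_zobj A.

Definition badd (A B : C) (f g : Hom A B) : Hom A B :=
  bcopair (idm B) (idm B) ∘ bpair f g.

Lemma bzero_comp (A B B' : C) (x : Hom A B) : bzero B B' ∘ x = bzero A B'.
Proof.
  unfold bzero. rewrite <- comp_assoc. f_equal. apply to_zobj_unique.
Qed.

Lemma comp_bzero (A B B' : C) (x : Hom B B') : x ∘ bzero A B = bzero A B'.
Proof.
  unfold bzero. rewrite comp_assoc. f_equal. apply from_zobj_unique.
Qed.

Lemma bpair_ext (Z A B : C) (h k : Hom Z (bip A B)) :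
  bproj0 A B ∘ h = bproj0 A B ∘ k -> bproj1 A B ∘ h = bproj1 A B ∘ k -> h = k.
Proof.
  intros H0 H1.
  rewrite (bpair_unique H0 H1). symmetry. now apply bpair_unique.
Qed.

Lemma bpair_comp (Y Z A B : C) (f : Hom Z A) (g : Hom Z B) (x : Hom Y Z) :
  bpair f g ∘ x = bpair (f ∘ x) (g ∘ x).
Proof.
  apply bpair_unique; rewrite comp_assoc; [rewrite bproj0_pair | rewrite bproj1_pair];
    reflexivity.
Qed.

Lemma binj0_comp (Z A B : C) (f : Hom Z A) :
  binj0 A B ∘ f = bpair f (bzero Z B).
Proof.
  apply bpair_unique; rewrite comp_assoc.
  - now rewrite bproj0_inj0, comp_id_l.
  - rewrite bproj1_inj0. apply bzero_comp.
Qed.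

Lemma binj1_comp (Z A B : C) (f : Hom Z B) :
  binj1 A B ∘ f = bpair (bzero Z A) f.
Proof.
  apply bpair_unique; rewrite comp_assoc.
  - rewrite bproj0_inj1. apply bzero_comp.
  - now rewrite bproj1_inj1, comp_id_l.
Qed.

Lemma badd_comp (A B B' : C) (f g : Hom B B') (x : Hom A B) :
  badd f g ∘ x = badd (f ∘ x) (g ∘ x).
Proof. unfold badd. now rewrite <- comp_assoc, bpair_comp. Qed.

Lemma comp_badd (A B B' : C) (h : Hom B B') (f g : Hom A B) :
  h ∘ badd f g = badd (h ∘ f) (h ∘ g).
Proof.
  unfold badd.
  set (hh := bpair (h ∘ bproj0 B B) (h ∘ bproj1 B B)).
  assert (E : bpair (h ∘ f) (h ∘ g) = hh ∘ bpair f g).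
  { unfold hh.
    now rewrite bpair_comp, <- !comp_assoc, bproj0_pair, bproj1_pair. }
  rewrite E, !comp_assoc. f_equal.
  transitivity (bcopair h h); [| symmetry]; apply bcopair_unique;
    rewrite <- comp_assoc.
  - now rewrite bcopair_inj0, comp_id_r.
  - now rewrite bcopair_inj1, comp_id_r.
  - unfold hh. rewrite bpair_comp, <- !comp_assoc, bproj0_inj0, bproj1_inj0.
    fold (bzero B B). rewrite comp_bzero, comp_id_r, <- binj0_comp.
    now rewrite comp_assoc, bcopair_inj0, comp_id_l.
  - unfold hh. rewrite bpair_comp, <- !comp_assoc, bproj0_inj1, bproj1_inj1.
    fold (bzero B B). rewrite comp_bzero, comp_id_r, <- binj1_comp.
    now rewrite comp_assoc, bcopair_inj1, comp_id_l.
Qed.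

Lemma badd_0_l (A B : C) (f : Hom A B) : badd (bzero A B) f = f.
Proof.
  unfold badd. now rewrite <- binj1_comp, comp_assoc, bcopair_inj1, comp_id_l.
Qed.

Lemma badd_0_r (A B : C) (f : Hom A B) : badd f (bzero A B) = f.
Proof.
  unfold badd. now rewrite <- binj0_comp, comp_assoc, bcopair_inj0, comp_id_l.
Qed.

Lemma badd_interchange (A B : C) (f g h k : Hom A B) :
  badd (badd f g) (badd h k) = badd (badd f h) (badd g k).
Proof.
  assert (E : bpair (badd f h) (badd g k) = badd (bpair f g) (bpair h k)).
  { symmetry. apply bpair_unique; rewrite comp_badd.
    - now rewrite !bproj0_pair.
    - now rewrite !bproj1_pair. }
  transitivity (bcopair (idm B) (idm B) ∘ bpair (badd f h) (badd g k)).
  - rewrite E, comp_badd. reflexivity.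
  - reflexivity.
Qed.

Lemma badd_assoc (A B : C) (f g h : Hom A B) :
  badd f (badd g h) = badd (badd f g) h.
Proof.
  transitivity (badd (badd f (bzero A B)) (badd g h)).
  - now rewrite badd_0_r.
  - now rewrite badd_interchange, badd_0_l.
Qed.

Lemma badd_comm (A B : C) (f g : Hom A B) : badd f g = badd g f.
Proof.
  transitivity (badd (badd (bzero A B) f) (badd g (bzero A B))).
  - now rewrite badd_0_l, badd_0_r.
  - now rewrite badd_interchange, badd_0_l, badd_0_r.
Qed.

End BiproductAddition.

#[export] Instance biproduct_CLA (C : Category) (BP : FiniteBiproducts C) :
  CartesianLeftAdditive C :=
  {| addm := @badd C BP;
     zerom := @bzero C BP;
     addm_assoc := @badd_assoc C BP;
     addm_comm := @badd_comm C BP;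
     addm_0_l := @badd_0_l C BP;
     addm_comp := @badd_comp C BP;
     zerom_comp := @bzero_comp C BP;
     top := zobj;
     to_top := @to_zobj C BP;
     to_top_unique := @to_zobj_unique C BP;
     prod := @bip C BP;
     proj0 := @bproj0 C BP;
     proj1 := @bproj1 C BP;
     pair := @bpair C BP;
     proj0_pair := @bproj0_pair C BP;
     proj1_pair := @bproj1_pair C BP;
     pair_unique := @bpair_unique C BP;
     proj0_add := fun Z A B x y => comp_badd (bproj0 A B) x y;
     proj0_0 := fun Z A B => comp_bzero Z (bproj0 A B);
     proj1_add := fun Z A B x y => comp_badd (bproj1 A B) x y;
     proj1_0 := fun Z A B => comp_bzero Z (bproj1 A B) |}.

Lemma biproduct_additive (C : Category) (BP : FiniteBiproducts C) (A B : C)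
  (f : Hom A B) : additive f.
Proof.
  split.
  - intros Z x y. apply comp_badd.
  - intros Z. apply comp_bzero.
Qed.

Lemma biproduct_inj0 (C : Category) (BP : FiniteBiproducts C) (A B : C) :
  binj0 A B = (inj0 : Hom A (A × B)).
Proof. rewrite <- (comp_id_r (binj0 A B)). apply binj0_comp. Qed.

Lemma biproduct_inj1 (C : Category) (BP : FiniteBiproducts C) (A B : C) :
  binj1 A B = (inj1 : Hom B (A × B)).
Proof. rewrite <- (comp_id_r (binj1 A B)). apply binj1_comp. Qed.

Record DifferentialCombinator (C : Category) (CLA : CartesianLeftAdditive C) := {
  diff : forall A B : C, Hom A B -> Hom (A × A) B;
  CD1_add : forall (A B : C) (f g : Hom A B), diff (f + g) = diff f + diff g;
  CD1_zero : forall A B : C, diff (0 : Hom A B) = 0;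
  CD2_add : forall (A B : C) (f : Hom A B),
    diff f ∘ (idm A ×m nabla A)
    = diff f ∘ (idm A ×m π0) + diff f ∘ (idm A ×m π1);
  CD2_zero : forall (A B : C) (f : Hom A B), diff f ∘ inj0 = 0;
  CD3_id : forall A : C, diff (idm A) = π1;
  CD3_proj0 : forall A B : C, diff (π0 : Hom (A × B) A) = π0 ∘ π1;
  CD3_proj1 : forall A B : C, diff (π1 : Hom (A × B) B) = π1 ∘ π1;
  CD4 : forall (Z A B : C) (f : Hom Z A) (g : Hom Z B),
    diff ⟨f, g⟩ = ⟨diff f, diff g⟩;
  CD5 : forall (A B B' : C) (g : Hom B B') (f : Hom A B),
    diff (g ∘ f) = diff g ∘ ⟨f ∘ π0, diff f⟩;
  CD6 : forall (A B : C) (f : Hom A B), diff (diff f) ∘ lift A = diff f;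
  CD7 : forall (A B : C) (f : Hom A B),
    diff (diff f) ∘ flip A = diff (diff f)
}.

Arguments DifferentialCombinator C {CLA}.
Arguments diff {C CLA} D {A B} f : rename.

Definition D_linear (C : Category) (CLA : CartesianLeftAdditive C)
    (D : DifferentialCombinator C) (A B : C) (f : Hom A B) : Prop :=
  diff D f = f ∘ π1.

Record is_differential_combinator_transformation (X : Category)
    (BP : FiniteBiproducts X) (M : Comonad X)
    (d : forall A : X, Hom (M (A × A)) (M A)) : Prop := {
  dc_natural : is_natural (comp_functor M (square_functor X)) M d;
  dc1 : forall A : X, d A ∘ fmap M (inj0 : Hom A (A × A)) = 0;
  dc2 : forall A : X,
    d A ∘ fmap M (idm A ×m nabla A)
    = d A ∘ (fmap M (idm A ×m π0) + fmap M (idm A ×m π1));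
  dc3 : forall A : X, counit M A ∘ d A = π1 ∘ counit M (A × A);
  dc4 : forall A : X,
    dup M A ∘ d A = d (M A) ∘ fmap M ⟨fmap M π0, d A⟩ ∘ dup M (A × A);
  dc5 : forall A : X, d A ∘ d (A × A) ∘ fmap M (lift A) = d A;
  dc6 : forall A : X, d A ∘ d (A × A) ∘ fmap M (flip A) = d A ∘ d (A × A)
}.

Arguments is_differential_combinator_transformation {X BP} M d.

(* A property of the quadruple (!, δ, ε, ∂) given by [M] and [d]. *)
Definition is_cartesian_differential_comonad (X : Category)
    (BP : FiniteBiproducts X) (M : Comonad X)
    (d : forall A : X, Hom (M (A × A)) (M A)) : Prop :=
  is_differential_combinator_transformation M d.

Arguments is_cartesian_differential_comonad {X BP} M d.

(* Main.v *)
Require Import Defs.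

Open Scope cat_scope.

(** A coKleisli map [f : A -> B] is a map [M A -> B] of the base category, and
    there it factors as itself after the identity of [M A]; read in the coKleisli
    category, this says that [f] is the universal map [phi A : A -> M A] followed
    by the image under [coKleisli_F] of [f].  Maps in that image are [D]-linear,
    so the chain rule reduces [D[f]] to [D[phi A]] followed by that image, that
    is, to [⟦f⟧ ∘ d A] ([diff_factors_through_phi]).  Differentiating is thus
    precomposing with [d] in the base category.

    Each axiom for [d] is then an axiom of [D] taken at a suitable map: naturality
    is the chain rule at [phi B] after the image of [f], [dc3] is [CD3] at the
    identity, [dc4] is the chain rule at [phi (M A)] after [phi A], whose
    underlying map is the comultiplication, and the others are [CD2], [CD6] and
    [CD7] at [phi A]; for [dc2] the sum is moved past [d A], which is additive like
    every map of a category with biproducts.  To read [CD2], [CD6] and [CD7] in the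
    base category, the structural maps of the coKleisli category are recognised
    as the images of those of the base ([coKleisli_F_inj0] to
    [coKleisli_F_flip]), because precomposing with the image of [h] in the
    coKleisli category is precomposing with [fmap M h] in the base
    ([coKleisli_comp_F]). *)

(** Naturality of the counit moves it next to the comultiplication, where the
    two cancel. *)
Lemma coKleisli_F_comp {X : Category} (M : Comonad X) {A B B' : X}
    (g : @Hom X B B') (f : @Hom (coKleisli M) A B) :
  ⟦fmap (coKleisli_F M) g ∘ f⟧ = g ∘ ⟦f⟧.
Proof.
  unfold bracket; simpl.
  rewrite <- (comp_assoc g), counit_fmap.
  now rewrite <- !comp_assoc, counit_dup, comp_id_r.
Qed.

Lemma coKleisli_comp_F {X : Category} (M : Comonad X) {A B B' : X}
    (g : @Hom (coKleisli M) B B') (f : @Hom X A B) :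
  ⟦g ∘ fmap (coKleisli_F M) f⟧ = ⟦g⟧ ∘ fmap M f.
Proof.
  unfold bracket; simpl.
  now rewrite fmap_comp, <- !comp_assoc, fmap_counit_dup, comp_id_r.
Qed.

Lemma coKleisli_F_comp_phi {X : Category} (M : Comonad X) {A B : X}
    (f : @Hom (coKleisli M) A B) :
  fmap (coKleisli_F M) ⟦f⟧ ∘ phi M A = f.
Proof. exact (eq_trans (coKleisli_F_comp M ⟦f⟧ (phi M A)) (comp_id_r _)). Qed.

Lemma pair_comp {C : Category} {CLA : CartesianLeftAdditive C} {Y Z A B : C}
    (f : Hom Z A) (g : Hom Z B) (x : Hom Y Z) :
  ⟨f, g⟩ ∘ x = ⟨f ∘ x, g ∘ x⟩.
Proof.
  apply pair_unique; rewrite comp_assoc;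
    [now rewrite proj0_pair | now rewrite proj1_pair].
Qed.

Lemma coKleisli_F_pair {X : Category} {CLA : CartesianLeftAdditive X}
    (M : Comonad X) {Z A B : X} (f : @Hom X Z A) (g : @Hom X Z B) :
  fmap (coKleisli_F M) ⟨f, g⟩
  = ⟨fmap (coKleisli_F M) f, fmap (coKleisli_F M) g⟩.
Proof. exact (pair_comp f g (counit M Z)). Qed.

Lemma coKleisli_F_prodm {X : Category} {CLA : CartesianLeftAdditive X}
    (M : Comonad X) {A A' B B' : X} (h : @Hom X A A') (k : @Hom X B B') :
  fmap (coKleisli_F M) (h ×m k)
  = fmap (coKleisli_F M) h ×m fmap (coKleisli_F M) k.
Proof.
  unfold prodm. rewrite coKleisli_F_pair, !(fmap_comp (coKleisli_F M)).
  reflexivity.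
Qed.

Lemma coKleisli_F_inj0 {X : Category} {CLA : CartesianLeftAdditive X}
    (M : Comonad X) (A B : X) :
  fmap (coKleisli_F M) (inj0 : @Hom X A (A × B))
  = (inj0 : @Hom (coKleisli M) A (prod (C := coKleisli M) A B)).
Proof.
  unfold inj0. rewrite coKleisli_F_pair, fmap_id. f_equal.
  exact (@zerom_comp X CLA _ _ _ (counit M A)).
Qed.

Lemma coKleisli_F_inj1 {X : Category} {CLA : CartesianLeftAdditive X}
    (M : Comonad X) (A B : X) :
  fmap (coKleisli_F M) (inj1 : @Hom X B (A × B))
  = (inj1 : @Hom (coKleisli M) B (prod (C := coKleisli M) A B)).
Proof.
  unfold inj1. rewrite coKleisli_F_pair, fmap_id. f_equal.
  exact (@zerom_comp X CLA _ _ _ (counit M B)).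
Qed.

Lemma coKleisli_F_nabla {X : Category} {CLA : CartesianLeftAdditive X}
    (M : Comonad X) (A : X) :
  fmap (coKleisli_F M) (nabla A) = @nabla (coKleisli M) _ A.
Proof. exact (@addm_comp X CLA _ _ _ π0 π1 (counit M (A × A))). Qed.

Lemma coKleisli_F_lift {X : Category} {CLA : CartesianLeftAdditive X}
    (M : Comonad X) (A : X) :
  fmap (coKleisli_F M) (lift A) = @lift (coKleisli M) _ A.
Proof.
  unfold lift. rewrite coKleisli_F_prodm, coKleisli_F_inj0, coKleisli_F_inj1.
  reflexivity.
Qed.

Lemma coKleisli_F_flip {X : Category} {CLA : CartesianLeftAdditive X}
    (M : Comonad X) (A : X) :
  fmap (coKleisli_F M) (flip A) = @flip (coKleisli M) _ A.
Proof.
  unfold flip. rewrite coKleisli_F_pair, !coKleisli_F_prodm. reflexivity.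
Qed.

(** By linearity the chain rule for an image after [f] retains only the
    derivative of [f]. *)
Lemma diff_F_comp {X : Category} {CLA : CartesianLeftAdditive X}
    (M : Comonad X) (D : DifferentialCombinator (coKleisli M)) {A B B' : X}
    (g : @Hom X B B') (f : @Hom (coKleisli M) A B) :
  D_linear D (fmap (coKleisli_F M) g) ->
  diff D (fmap (coKleisli_F M) g ∘ f) = fmap (coKleisli_F M) g ∘ diff D f.
Proof.
  intros L. rewrite CD5, L, <- comp_assoc, proj1_pair. reflexivity.
Qed.

(** By linearity the pair in the chain rule for [g] after an image is the square
    of that image. *)
Lemma diff_comp_F {X : Category} {CLA : CartesianLeftAdditive X}
    (M : Comonad X) (D : DifferentialCombinator (coKleisli M)) {A B B' : X}
    (g : @Hom (coKleisli M) B B') (f : @Hom X A B) :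
  D_linear D (fmap (coKleisli_F M) f) ->
  diff D (g ∘ fmap (coKleisli_F M) f)
  = diff D g ∘ fmap (coKleisli_F M) (f ×m f).
Proof.
  intros L. rewrite coKleisli_F_prodm. unfold prodm.
  etransitivity; [apply CD5 | do 2 f_equal; exact L].
Qed.

(** The derivative of [phi A] is universal: every coKleisli map out of [A] is
    [phi A] followed by a linear map. *)
Lemma diff_factors_through_phi {X : Category} {CLA : CartesianLeftAdditive X}
    (M : Comonad X) (D : DifferentialCombinator (coKleisli M)) {A B : X}
    (f : @Hom (coKleisli M) A B) :
  D_linear D (fmap (coKleisli_F M) ⟦f⟧) ->
  ⟦diff D f⟧ = ⟦f⟧ ∘ ⟦diff D (phi M A)⟧.
Proof.
  intros L. transitivity ⟦diff D (fmap (coKleisli_F M) ⟦f⟧ ∘ phi M A)⟧.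
  - now rewrite coKleisli_F_comp_phi.
  - rewrite (diff_F_comp M D _ _ L). apply coKleisli_F_comp.
Qed.

Theorem proposition3p6 (X : Category) (BP : FiniteBiproducts X) (M : Comonad X)
  (D : @DifferentialCombinator (coKleisli M)
         (coKleisli_CLA (biproduct_CLA BP) M))
  (F_linear : forall (A B : X) (f : @Hom X A B), D_linear D (fmap (coKleisli_F M) f)) :
  let d := (fun A : X => ⟦diff D (phi M A)⟧)
           : forall A : X, @Hom X (M (A × A)) (M A) in
  is_natural (comp_functor M (square_functor X)) M d
  /\ is_cartesian_differential_comonad M d
  /\ (forall (A B : X) (f : @Hom (coKleisli M) A B),
        ⟦diff D f⟧ = ⟦f⟧ ∘ d A).
Proof.
  intros d.
  assert (diffE : forall (A B : X) (f : @Hom (coKleisli M) A B),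
             ⟦diff D f⟧ = ⟦f⟧ ∘ d A).
  { intros A B f. apply diff_factors_through_phi, F_linear. }
  assert (diff2E : forall A : X, ⟦diff D (diff D (phi M A))⟧ = d A ∘ d (A × A)).
  { intros A. exact (diffE _ _ (diff D (phi M A))). }
  assert (nat : is_natural (comp_functor M (square_functor X)) M d).
  { intros A B f. simpl.
    (* The underlying map of [phi B] after the image of [f] is [fmap M f]. *)
    assert (E : phi M B ∘ fmap (coKleisli_F M) f
                = (fmap M f : @Hom (coKleisli M) A (M B))).
    { exact (eq_trans (coKleisli_comp_F M (phi M B) f) (comp_id_l _)). }
    transitivity ⟦diff D (phi M B ∘ fmap (coKleisli_F M) f)⟧.
    - rewrite (diff_comp_F M D _ _ (F_linear _ _ f)).
      symmetry. apply coKleisli_comp_F.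
    - rewrite E. apply diffE. }
  split; [exact nat | split; [| exact diffE]].
  split.
  - exact nat.
  - intros A. etransitivity; [symmetry; apply coKleisli_comp_F |].
    rewrite coKleisli_F_inj0. exact (CD2_zero D (phi M A)).
  - intros A.
    transitivity (d A ∘ fmap M (idm A ×m π0) + d A ∘ fmap M (idm A ×m π1)).
    + unfold d. rewrite <- !coKleisli_comp_F, !coKleisli_F_prodm.
      rewrite fmap_id, coKleisli_F_nabla. exact (CD2_add D (phi M A)).
    + symmetry. apply (biproduct_additive BP (d A)).
  - intros A. etransitivity; [symmetry; exact (diffE A A (counit M A)) |].
    exact (CD3_id D A).
  - intros A.
    assert (E : phi M (M A) ∘ phi M A
                = (dup M A : @Hom (coKleisli M) A (M (M A)))).
    { simpl. unfold phi. now rewrite comp_id_l, fmap_id, comp_id_l. }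
    etransitivity; [symmetry; exact (diffE _ _ (dup M A)) |].
    rewrite <- E, CD5. unfold bracket. simpl.
    do 3 f_equal.
    (* [phi A] after the first projection in the coKleisli category is
       [fmap M π0] in the base. *)
    unfold phi. rewrite comp_id_l, fmap_comp, <- comp_assoc, fmap_counit_dup.
    now rewrite comp_id_r.
  - intros A. rewrite <- diff2E, <- coKleisli_comp_F, coKleisli_F_lift.
    exact (CD6 D (phi M A)).
  - intros A. rewrite <- diff2E, <- coKleisli_comp_F, coKleisli_F_flip.
    exact (CD7 D (phi M A)).
Qed.
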